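(* $\mathrm{S}^{\neq}$ is closed under homomorphism.
   Context: Let $\Gamma=\Sigma\cup\{¢,\$\}$, where ¢ and \$ are left and right end-markers. A PFA $\mathcal{P}=(S,\Sigma,\{\mathsf{A}_\sigma:\sigma\in\Gamma\},F)$ has states $S=\{s_1,\dots,s_n\}$ (start state $s_1$), real stochastic $n\times n$ transition matrices $\mathsf{A}_\sigma$, and accepting states $F$; its acceptance probability on $w\in\Sigma^*$ is $f_{\mathcal{P}}(w)=\sum_{s_i\in F}\mathsf{v}(i)$, where $\mathsf{v}=(1,0,\dots,0)\mathsf{A}_{¢}\mathsf{A}_{w_1}\cdots\mathsf{A}_{w_{|w|}}\mathsf{A}_{\$}$. $\mathrm{S}^{\neq}$ (exclusive stochastic languages) is the class of languages of the form $\{w: f_{\mathcal{P}}(w)\neq\lambda\}$ for some PFA $\mathcal{P}$ and $\lambda\in[0,1]$. A homomorphism is a map $h:\Sigma\to\Upsilon^*$ extended to strings, possibly mapping some symbols to $\varepsilon$. *)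

(* Defs.v *)
From mathcomp Require Import all_boot all_order all_algebra.
From mathcomp Require Import classical_sets reals.

Set Implicit Arguments.
Unset Strict Implicit.
Unset Printing Implicit Defensive.

Import Order.TTheory GRing.Theory Num.Theory.
Local Open Scope ring_scope.
Local Open Scope classical_set_scope.

Definition language (Sigma : finType) : Type := set (seq Sigma).

(* The tape alphabet: Sigma together with the two end-markers. *)
Inductive tape_symbol (Sigma : finType) : Type :=
| LeftEnd
| RightEnd
| Letter of Sigma.

Arguments LeftEnd {Sigma}.
Arguments RightEnd {Sigma}.

(* State distributions are row vectors acted on from the right, so
   "stochastic" means that every row sums to 1. *)
Definition stochastic (R : realType) (n : nat) (A : 'M[R]_n) : Prop :=
  (forall i j, 0 <= A i j) /\ (forall i, \sum_j A i j = 1).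

(* A PFA has pfa_dim.+1 >= 1 states, indexed by 'I_pfa_dim.+1; the start
   state is ord0. *)
Record pfa (R : realType) (Sigma : finType) : Type := Pfa {
  pfa_dim : nat;
  pfa_trans : tape_symbol Sigma -> 'M[R]_pfa_dim.+1;
  pfa_accept : {set 'I_pfa_dim.+1};
  pfa_stochastic : forall s, stochastic (pfa_trans s)
}.

Definition pfa_final_dist (R : realType) (Sigma : finType) (P : pfa R Sigma)
    (w : seq Sigma) : 'rV[R]_(pfa_dim P).+1 :=
  delta_mx 0 ord0 *m pfa_trans P LeftEnd
    *m (\prod_(a <- w) pfa_trans P (Letter a))
    *m pfa_trans P RightEnd.

Definition pfa_prob (R : realType) (Sigma : finType) (P : pfa R Sigma)
    (w : seq Sigma) : R :=
  \sum_(i in pfa_accept P) pfa_final_dist P w 0 i.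

Definition exclusive_stochastic (R : realType) (Sigma : finType)
    (L : language Sigma) : Prop :=
  exists (P : pfa R Sigma) (lambda : R),
    0 <= lambda <= 1 /\ L = [set w | pfa_prob P w <> lambda].

Definition hom_ext (Sigma Upsilon : finType) (h : Sigma -> seq Upsilon)
    (w : seq Sigma) : seq Upsilon :=
  flatten [seq h a | a <- w].

(* Main.v *)
(** Up to a shift by the cutpoint, a language is exclusive stochastic iff it is
    the support of a real weighted automaton; the passage back to a PFA with
    cutpoint 1/2 is Turakainen's construction.  So let [f] be the weight of an
    automaton.  Squaring it (product automaton) keeps the support and makes the
    weight nonnegative, so that summing [f u ^ 2] over the preimages [u] of a
    word cannot cancel.  Erased symbols make this sum infinite, but it may be
    truncated: tracing the production of [h u] step by step with silent moves,
    the weight as a function of the length of a block of silent moves satisfies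
    a linear recurrence (Cayley-Hamilton), hence if it is nonzero for some
    length it is nonzero for a length below a fixed bound. *)

Require Import Defs.
From mathcomp Require Import all_boot all_order all_algebra.
From mathcomp Require Import classical_sets reals.
From mathcomp Require Import ring lra.
Set Implicit Arguments.
Unset Strict Implicit.
Unset Printing Implicit Defensive.
Import Order.TTheory GRing.Theory Num.Theory.
Local Open Scope ring_scope.

(** * Weighted automata and the square of a weight *)

Record wfa (R : realFieldType) (A : Type) : Type := Wfa {
  wfa_state : finType;
  wfa_init : wfa_state -> R;
  wfa_trans : A -> wfa_state -> wfa_state -> R;
  wfa_fin : wfa_state -> R
}.

Fixpoint behaviour (R : realFieldType) (A : Type) (W : wfa R A) (w : seq A)
    : wfa_state W -> R :=
  if w is a :: w' then
    fun t => \sum_t' wfa_trans a t t' * behaviour w' t'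
  else wfa_fin (w := W).
Arguments behaviour {R A} W w _.

Definition weight (R : realFieldType) (A : Type) (W : wfa R A) (w : seq A) : R :=
  \sum_t wfa_init t * behaviour W w t.

Definition wfa_square (R : realFieldType) (A : Type) (W : wfa R A) : wfa R A :=
  @Wfa R A (wfa_state W * wfa_state W)%type
    (fun s => wfa_init s.1 * wfa_init s.2)
    (fun a s s' => wfa_trans a s.1 s'.1 * wfa_trans a s.2 s'.2)
    (fun s => wfa_fin s.1 * wfa_fin s.2).

Lemma behaviour_square (R : realFieldType) (A : Type) (W : wfa R A) (w : seq A)
    (s : wfa_state (wfa_square W)) :
  behaviour (wfa_square W) w s = behaviour W w s.1 * behaviour W w s.2.
Proof.
elim: w s => [//|a w IHw] [s1 s2] /=.
rewrite big_distrlr pair_bigA; apply: eq_bigr => -[t1 t2] _ /=.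
by rewrite IHw /= mulrACA.
Qed.

Lemma weight_square (R : realFieldType) (A : Type) (W : wfa R A) (w : seq A) :
  weight (wfa_square W) w = weight W w ^+ 2.
Proof.
rewrite expr2 /weight big_distrlr pair_bigA; apply: eq_bigr => -[t1 t2] _ /=.
by rewrite behaviour_square /= mulrACA.
Qed.

(** * Images under letter-to-letter maps *)

(** Since [l] maps letters to letters, a word has finitely many preimages, all of its own length.
    Each is listed once, so sums of weights may range over the list. *)
Fixpoint preimages (A : finType) (B : eqType) (l : A -> B) (p : seq B)
    : seq (seq A) :=
  if p is b :: p' then
    [seq a :: x | a <- [seq a <- enum A | l a == b], x <- preimages l p']
  else [:: [::]].

Lemma mem_preimages (A : finType) (B : eqType) (l : A -> B) (p : seq B)
    (x : seq A) :
  (x \in preimages l p) = (map l x == p).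
Proof.
elim: p x => [|b p IHp] [|a x] //=.
  by apply/negP => /allpairsP[[a' x'] []].
apply/allpairsP/eqP => [[[a' x'] /= []]|[<- /eqP px]].
  by rewrite mem_filter IHp => /andP[/eqP <- _] /eqP <- [-> ->].
by exists (a, x); rewrite mem_filter eqxx mem_enum IHp.
Qed.

Definition wfa_relabel (R : realFieldType) (A : finType) (B : eqType)
    (l : A -> B) (W : wfa R A) : wfa R B :=
  @Wfa R B (wfa_state W) (wfa_init (w := W))
    (fun b t t' => \sum_(a | l a == b) wfa_trans a t t')
    (wfa_fin (w := W)).

Lemma behaviour_relabel (R : realFieldType) (A : finType) (B : eqType)
    (l : A -> B) (W : wfa R A) (p : seq B) (t : wfa_state W) :
  behaviour (wfa_relabel l W) p t = \sum_(x <- preimages l p) behaviour W x t.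
Proof.
elim: p t => [|b p IHp] t /=; first by rewrite big_seq1.
rewrite big_allpairs_dep big_filter big_enum_cond /=.
under eq_bigr do rewrite mulr_suml.
rewrite exchange_big; apply: eq_bigr => a _.
rewrite exchange_big; apply: eq_bigr => t' _ /=.
by rewrite IHp mulr_sumr.
Qed.

Lemma weight_relabel (R : realFieldType) (A : finType) (B : eqType)
    (l : A -> B) (W : wfa R A) (p : seq B) :
  weight (wfa_relabel l W) p = \sum_(x <- preimages l p) weight W x.
Proof.
rewrite exchange_big; apply: eq_bigr => t _ /=.
by rewrite behaviour_relabel mulr_sumr.
Qed.

(** * Unfolding a homomorphism into silent and emitting moves *)

(* The buffer component holds the part of [h a] not yet emitted: reading
   [inl a] simulates [a] and loads [h a], reading [inr c] pops [c]. *)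
Definition wfa_unfold (R : realFieldType) (A B : finType) (h : A -> seq B)
    (W : wfa R A) : wfa R (A + B) :=
  @Wfa R (A + B)%type
    (wfa_state W * {bseq \max_a size (h a) of B})%type
    (fun s => if val s.2 == [::] then wfa_init s.1 else 0)
    (fun x s s' =>
       match x with
       | inl a => if (val s.2 == [::]) && (val s'.2 == h a)
                  then wfa_trans a s.1 s'.1 else 0
       | inr c => ((val s.2 == c :: val s'.2) && (s.1 == s'.1))%:R
       end)
    (fun s => if val s.2 == [::] then wfa_fin s.1 else 0).

(** A trace [x] determines its source word: [decode] succeeds exactly when [x] first emits [r] and
    then, after each [inl a], emits all of [h a]. *)
Fixpoint decode (A : Type) (B : eqType) (h : A -> seq B) (r : seq B)
    (x : seq (A + B)) : option (seq A) :=
  match r, x with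
  | [::], [::] => Some [::]
  | [::], inl a :: x' => omap (cons a) (decode h (h a) x')
  | c :: r', inr d :: x' => if c == d then decode h r' x' else None
  | _, _ => None
  end.

(** The buffer evolves deterministically along a trace, so only the runs of [W] on the decoded word
    contribute; a trace that fails to decode blocks. *)
Lemma behaviour_unfold (R : realFieldType) (A B : finType) (h : A -> seq B)
    (W : wfa R A) (x : seq (A + B)) (s : wfa_state (wfa_unfold h W)) :
  behaviour (wfa_unfold h W) x s
    = oapp (fun u => behaviour W u s.1) 0 (decode h (val s.2) x).
Proof.
elim: x s => [|[a|d] x IHx] [t [r ltr]] /=; first by case: r {ltr}.
- case: r ltr => [|c r] ltr /=; last by rewrite big1 // => s _; rewrite mul0r.
  have lha : (size (h a) <= \max_a size (h a))%N by apply: leq_bigmax.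
  transitivity (\sum_t' wfa_trans a t t' * behaviour (wfa_unfold h W) x (t', Bseq lha)).
    transitivity (\sum_t' \sum_(r : {bseq \max_a size (h a) of B})
        (if val r == h a then wfa_trans a t t' else 0)
          * behaviour (wfa_unfold h W) x (t', r)).
      by rewrite pair_bigA; apply: eq_bigr => -[].
    apply: eq_bigr => t' _; rewrite (bigD1 (Bseq lha)) //= eqxx.
    rewrite [X in _ + X]big1 ?addr0 // => r.
    by rewrite -val_eqE /= => /negPf ->; rewrite mul0r.
  case E: (decode h (h a) x) => [u|] /=.
    by apply: eq_bigr => t' _; rewrite IHx /= E.
  by rewrite big1 // => t' _; rewrite IHx /= E mulr0.
- case: r ltr => [|c r] ltr /=; first by rewrite big1 // => s _; rewrite mul0r.
  have [<-|neq_cd] := eqVneq c d; last first.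
    by rewrite big1 // => s _; rewrite eqseq_cons (negPf neq_cd) mul0r.
  rewrite (bigD1 (t, Bseq (ltnW ltr))) //= !eqxx mul1r IHx.
  rewrite [X in _ + X]big1 ?addr0 // => -[t' r'] neq_s; rewrite eqseq_cons eqxx /=.
  suff -> : (r == r') && (t == t') = false by rewrite mul0r.
  apply: contraNF neq_s => /andP[/eqP eq_r /eqP ->].
  by apply/eqP; congr pair; apply: val_inj.
Qed.

Lemma weight_unfold (R : realFieldType) (A B : finType) (h : A -> seq B)
    (W : wfa R A) (x : seq (A + B)) :
  weight (wfa_unfold h W) x = oapp (weight W) 0 (decode h [::] x).
Proof.
transitivity (\sum_t wfa_init t * behaviour (wfa_unfold h W) x (t, [bseq])).
  transitivity (\sum_t \sum_(r : {bseq \max_a size (h a) of B})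
      (if val r == [::] then wfa_init t else 0)
        * behaviour (wfa_unfold h W) x (t, r)).
    by rewrite pair_bigA; apply: eq_bigr => -[].
  apply: eq_bigr => t _; rewrite (bigD1 [bseq]) //=.
  rewrite [X in _ + X]big1 ?addr0 // => r.
  by rewrite -val_eqE /= => /negPf ->; rewrite mul0r.
transitivity (\sum_t wfa_init t
    * oapp (fun u => behaviour W u t) 0 (decode h [::] x)).
  by apply: eq_bigr => t _; rewrite behaviour_unfold.
by case: (decode _ _ _) => [u|] //=; rewrite big1 // => t _; rewrite mulr0.
Qed.

Definition emitted (A B : Type) (x : A + B) : option B :=
  if x is inr b then Some b else None.

Lemma decode_pmap (A : Type) (B : eqType) (h : A -> seq B) (r : seq B)
    (x : seq (A + B)) (u : seq A) :
  decode h r x = Some u ->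
  pmap id (map (@emitted A B) x) = r ++ flatten [seq h a | a <- u].
Proof.
elim: x r u => [|[a|d] x IHx] [|c r] u //=; first by case=> <-.
  by case E: (decode _ _ _) => [v|] //= [<-] /=; exact: IHx.
by case: eqP => // <- /IHx ->.
Qed.

(** Every source word has a canonical trace, so no preimage is lost by unfolding. *)
Lemma decode_flatten (A : Type) (B : eqType) (h : A -> seq B) (u : seq A) :
  decode h [::] (flatten [seq inl a :: map inr (h a) | a <- u]) = Some u.
Proof.
elim: u => [//|a u IHu] /=.
suff -> : forall r x, decode h r (map inr r ++ x) = decode h [::] x by rewrite IHu.
by elim=> [|c r IHr] x //=; rewrite eqxx.
Qed.

(** * Bounding a block of equal letters by Cayley-Hamilton *)

Fixpoint trans_pow (R : realFieldType) (A : Type) (W : wfa R A) (a : A) (k : nat)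
    (t t' : wfa_state W) : R :=
  if k is k'.+1 then \sum_s wfa_trans a t s * trans_pow a k' s t'
  else (t == t')%:R.

Lemma behaviour_nseq (R : realFieldType) (A : Type) (W : wfa R A) (a : A)
    (k : nat) (p : seq A) (t : wfa_state W) :
  behaviour W (nseq k a ++ p) t = \sum_s trans_pow a k t s * behaviour W p s.
Proof.
elim: k t => [|k IHk] t /=.
  rewrite (bigD1 t) //= eqxx mul1r big1 ?addr0 // => s.
  by rewrite eq_sym => /negPf ->; rewrite mul0r.
under eq_bigr do rewrite IHk mulr_sumr.
rewrite exchange_big; apply: eq_bigr => s _.
by rewrite mulr_suml; apply: eq_bigr => t' _; rewrite mulrA.
Qed.

Lemma trans_pow_mx (R : realFieldType) (A : Type) (W : wfa R A) (a : A) (n : nat)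
    (f : 'I_n.+1 -> wfa_state W) (k : nat) (i j : 'I_n.+1) :
  bijective f ->
  trans_pow a k (f i) (f j) = ((\matrix_(i, j) wfa_trans a (f i) (f j)) ^+ k) i j.
Proof.
move=> bij_f; elim: k i => [|k IHk] i /=.
  by rewrite expr0 mxE (inj_eq (bij_inj bij_f)).
rewrite exprS mxE (reindex f) /=; last exact: onW_bij.
by apply: eq_bigr => l _; rewrite IHk mxE.
Qed.

Lemma trans_pow_recurrence (R : realFieldType) (A : Type) (W : wfa R A) (a : A) :
  exists (n : nat) (c : 'I_n -> R), forall t t' : wfa_state W,
    trans_pow a n t t' = \sum_(k < n) c k * trans_pow a k t t'.
Proof.
case card_W: #|wfa_state W| => [|n].
  (* Square matrices form a ring here only in positive dimension, so the automaton without states is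
     treated apart. *)
  by exists 0%N, (fun=> 0) => t; have := fintype0 t card_W.
pose f (i : 'I_n.+1) : wfa_state W := enum_val (cast_ord (esym card_W) i).
have bij_f : bijective f.
  apply: bij_comp; first exact: enum_val_bij.
  exact: (Bijective (cast_ordK _) (cast_ordKV _)).
pose P := \matrix_(i, j) wfa_trans a (f i) (f j).
(* The characteristic polynomial is monic, so it expresses the top power through the lower ones. *)
exists n.+1, (fun k => - (char_poly P)`_k) => t t'.
case: (bij_f) => g _ fK; rewrite -(fK t) -(fK t') trans_pow_mx //.
under eq_bigr do rewrite trans_pow_mx //.
have /monicP := char_poly_monic P; rewrite lead_coefE size_char_poly /= => lead1.
have := Cayley_Hamilton P.
rewrite /horner_mx /horner_morph horner_coef size_map_poly size_char_poly.
rewrite big_ord_recr /= [(map_poly _ _)`_n.+1]coef_map lead1.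
rewrite -[_ * _ ^+ n.+1]/(_ *m _) mul_scalar_mx scale1r.
move=> /(canRL (addKr _)) ->; rewrite addr0 mxE summxE -sumrN.
apply: eq_bigr => k _; rewrite coef_map /= -[_ * _ ^+ _]/(_ *m _) mul_scalar_mx mxE.
by rewrite mulNr.
Qed.

(** Reading a prefix acts linearly on the behaviour vector of the suffix, so a linear relation
    between suffixes survives it. *)
Lemma weight_linear (R : realFieldType) (A : Type) (W : wfa R A) (n : nat)
    (c : 'I_n -> R) (p : seq A) (r : 'I_n -> seq A) (q : seq A) :
  (forall t, behaviour W p t = \sum_(k < n) c k * behaviour W (r k) t) ->
  weight W (q ++ p) = \sum_(k < n) c k * weight W (q ++ r k).
Proof.
move=> beh_p.
have beh_qp t : behaviour W (q ++ p) t
    = \sum_(k < n) c k * behaviour W (q ++ r k) t.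
  elim: q t => [//|a q IHq] t /=.
  under eq_bigr do rewrite IHq mulr_sumr.
  rewrite exchange_big; apply: eq_bigr => k _.
  by rewrite mulr_sumr; apply: eq_bigr => s _; rewrite mulrCA.
rewrite /weight; under eq_bigr do rewrite beh_qp mulr_sumr.
rewrite exchange_big; apply: eq_bigr => k _.
by rewrite mulr_sumr; apply: eq_bigr => s _; rewrite mulrCA.
Qed.

(** The bound is the order of the recurrence, hence uniform in the context [q], [p]. A longer block
    has weight a combination of weights with strictly shorter blocks, one of which must be
    nonzero. *)
Lemma weight_shorten (R : realFieldType) (A : Type) (W : wfa R A) (a : A) :
  exists n : nat, forall (q p : seq A) (m : nat),
    weight W (q ++ nseq m a ++ p) != 0 ->
    exists2 k, (k < n)%N & weight W (q ++ nseq k a ++ p) != 0.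
Proof.
have [n [c pow_n]] := trans_pow_recurrence W a.
exists n => q p m; elim/ltn_ind: m => m IHm nz_m.
have [lt_mn|le_nm] := ltnP m n; first by exists m.
have rec_n : weight W (q ++ nseq m a ++ p)
    = \sum_(k < n) c k * weight W (q ++ nseq (k + (m - n)) a ++ p).
  apply: weight_linear => t; rewrite -{1}(subnKC le_nm) nseqD -catA.
  rewrite behaviour_nseq; under eq_bigr do rewrite pow_n mulr_suml.
  rewrite exchange_big; apply: eq_bigr => k _ /=.
  rewrite nseqD -catA behaviour_nseq mulr_sumr.
  by apply: eq_bigr => s _; rewrite mulrA.
have [k nz_k|all0] := pickP (fun k : 'I_n =>
    weight W (q ++ nseq (k + (m - n)) a ++ p) != 0).
  by apply: IHm nz_k; rewrite -{2}(subnKC le_nm) ltn_add2r.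
case/eqP: nz_m; rewrite rec_n big1 // => k _.
by have /negbFE/eqP -> := all0 k; rewrite mulr0.
Qed.

(** * Elimination of silent letters *)

Fixpoint paddings (A : Type) (n : nat) (w : seq A) : seq (seq (option A)) :=
  if w is a :: w' then
    [seq nseq k None ++ Some a :: p | k <- iota 0 n, p <- paddings n w']
  else [seq nseq k None | k <- iota 0 n].

Lemma pmap_nseq_None (A : Type) (k : nat) (p : seq (option A)) :
  pmap id (nseq k None ++ p) = pmap id p.
Proof. by elim: k. Qed.

Lemma pmap_paddings (A : eqType) (n : nat) (w : seq A) (p : seq (option A)) :
  p \in paddings n w -> pmap id p = w.
Proof.
elim: w p => [|a w IHw] p /=.
  by case/mapP => k _ ->; rewrite -[nseq _ _]cats0 pmap_nseq_None.
by case/allpairsP => -[k p'] /= [_ /IHw <- ->]; rewrite pmap_nseq_None.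
Qed.

Lemma weight_paddings (R : realFieldType) (A : eqType) (W : wfa R (option A)) :
  exists n : nat, forall p, weight W p != 0 ->
    exists2 p', p' \in paddings n (pmap id p) & weight W p' != 0.
Proof.
have [n shorten] := weight_shorten W None.
exists n => p.
(* Blocks are shortened from left to right; [q] is the part already treated. *)
suff gen q : weight W (q ++ p) != 0 ->
    exists2 p', p' \in paddings n (pmap id p) & weight W (q ++ p') != 0.
  by move/(gen [::]).
have [w def_w] : exists w, w = pmap id p by exists (pmap id p).
rewrite -def_w; elim: w p q def_w => [|a w IHw] p q def_w nz_p.
  have def_p : p = nseq (size p) None ++ [::].
    rewrite cats0; elim: p def_w {nz_p} => [//|[a|] p IHp] //= def_w.
    by rewrite {1}IHp.
  move: nz_p; rewrite {1}def_p => /shorten[k lt_kn]; rewrite cats0 => nz_k.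
  by exists (nseq k None) => //; apply: map_f; rewrite mem_iota.
have [m [p1 [def_p def_p1]]] : exists m p1,
    p = nseq m None ++ Some a :: p1 /\ w = pmap id p1.
  elim: p def_w {nz_p} => [//|[b|] p IHp] /=.
    by case=> -> ->; exists 0%N, p.
  by move=> /IHp[m [p1 [-> ->]]]; exists m.+1, p1.
move: nz_p; rewrite def_p => /shorten[k lt_kn].
(* The shortened block and the letter closing it join the treated prefix. *)
rewrite -cat_rcons catA => /(IHw _ _ def_p1)[p' pad_p' nz_p'].
exists (nseq k None ++ Some a :: p'); last by rewrite -cat_rcons catA.
by apply/allpairsP; exists (k, p'); rewrite mem_iota.
Qed.

(** Silent-move elimination with the star of the silent matrix truncated to its first [n] powers,
    placed before each letter and before the final weights. *)
Definition wfa_erase (R : realFieldType) (A : Type) (n : nat)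
    (W : wfa R (option A)) : wfa R A :=
  @Wfa R A (wfa_state W) (wfa_init (w := W))
    (fun a t t' => \sum_(k <- iota 0 n) \sum_s
       trans_pow None k t s * wfa_trans (Some a) s t')
    (fun t => \sum_(k <- iota 0 n) \sum_s trans_pow None k t s * wfa_fin s).

Lemma behaviour_erase (R : realFieldType) (A : Type) (n : nat)
    (W : wfa R (option A)) (w : seq A) (t : wfa_state W) :
  behaviour (wfa_erase n W) w t = \sum_(p <- paddings n w) behaviour W p t.
Proof.
elim: w t => [|a w IHw] t /=.
  rewrite big_map; apply: eq_bigr => k _.
  by rewrite -[nseq k None]cats0 behaviour_nseq.
rewrite big_allpairs_dep; under eq_bigr do rewrite mulr_suml.
rewrite exchange_big; apply: eq_bigr => k _ /=.
under [RHS]eq_bigr do rewrite behaviour_nseq /=.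
rewrite [RHS]exchange_big; under eq_bigr do rewrite mulr_suml.
rewrite [LHS]exchange_big; apply: eq_bigr => s _ /=.
under [RHS]eq_bigr do rewrite mulr_sumr.
rewrite [RHS]exchange_big; apply: eq_bigr => t' _ /=.
rewrite IHw mulr_sumr; apply: eq_bigr => p _.
by rewrite mulrA.
Qed.

Lemma weight_erase (R : realFieldType) (A : Type) (n : nat)
    (W : wfa R (option A)) (w : seq A) :
  weight (wfa_erase n W) w = \sum_(p <- paddings n w) weight W p.
Proof.
rewrite exchange_big; apply: eq_bigr => t _ /=.
by rewrite behaviour_erase mulr_sumr.
Qed.

(** * Homomorphic images of supports *)

Lemma sumr_seq_neq0 (R : realFieldType) (I : eqType) (r : seq I) (F : I -> R) :
  (forall i, 0 <= F i) ->
  (\sum_(i <- r) F i != 0) <-> (exists2 i, i \in r & F i != 0).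
Proof.
move=> F_ge0; rewrite psumr_neq0 //; split=> [/hasP|] [i ri Fi].
  by exists i => //; rewrite gt_eqF.
by apply/hasP; exists i => //; rewrite lt_neqAle eq_sym Fi F_ge0.
Qed.

Lemma wfa_hom (R : realFieldType) (A B : finType) (h : A -> seq B) (W : wfa R A) :
  exists V : wfa R B, forall w,
    weight V w != 0 <-> (exists2 u, weight W u != 0 & hom_ext h u = w).
Proof.
pose U := wfa_unfold h (wfa_square W).
have U_ge0 x : 0 <= weight U x.
  rewrite weight_unfold; case: (decode _ _ _) => [u|] //=.
  by rewrite weight_square sqr_ge0.
pose E := wfa_relabel (@emitted A B) U.
have E_ge0 p : 0 <= weight E p by rewrite weight_relabel sumr_ge0.
have [n padE] := weight_paddings E.
exists (wfa_erase n E) => w.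
rewrite weight_erase sumr_seq_neq0 //; split=> [[p /pmap_paddings <-]|[u nz_u <-]].
  rewrite weight_relabel sumr_seq_neq0 // => -[x]; rewrite mem_preimages => /eqP <-.
  rewrite weight_unfold; case def_u: (decode _ _ _) => [u|] /=; last by rewrite eqxx.
  rewrite weight_square sqrf_eq0 => nz_u; exists u => //.
  by rewrite (decode_pmap def_u).
pose x : seq (A + B) := flatten [seq inl a :: map inr (h a) | a <- u].
have def_u : decode h [::] x = Some u := decode_flatten h u.
(* The shortened word supplied by [padE] may stem from a source word other than [u], but it still
   emits [hom_ext h u]. *)
have /padE : weight E (map (@emitted A B) x) != 0.
  rewrite weight_relabel; apply/sumr_seq_neq0 => //.
  exists x; first by rewrite mem_preimages.
  by rewrite weight_unfold def_u /= weight_square sqrf_eq0.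
by rewrite (decode_pmap def_u).
Qed.

(** * From PFAs with a cutpoint to weighted automata *)

Definition wfa_of_pfa (R : realType) (A : finType) (P : pfa R A) : wfa R A :=
  @Wfa R A 'I_(pfa_dim P).+1
    (fun j => pfa_trans P LeftEnd ord0 j)
    (fun a i j => pfa_trans P (Letter a) i j)
    (fun i => \sum_(j in pfa_accept P) pfa_trans P RightEnd i j).

Lemma pfa_prob_weight (R : realType) (A : finType) (P : pfa R A) (w : seq A) :
  pfa_prob P w = weight (wfa_of_pfa P) w.
Proof.
have beh_w i : behaviour (wfa_of_pfa P) w i = \sum_(j in pfa_accept P)
    ((\prod_(a <- w) pfa_trans P (Letter a)) *m pfa_trans P RightEnd) i j.
  elim: w i => [|a w IHw] i /=; first by rewrite big_nil mul1mx.
  under eq_bigr do rewrite IHw mulr_sumr.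
  rewrite exchange_big; apply: eq_bigr => j _.
  by rewrite big_cons -mulmxE -mulmxA mxE.
rewrite /pfa_prob /pfa_final_dist -rowE /weight.
under [RHS]eq_bigr do rewrite beh_w mulr_sumr.
rewrite exchange_big; apply: eq_bigr => j _.
by rewrite -mulmxA mxE; apply: eq_bigr => i _; rewrite mxE.
Qed.

(** Stochastic rows fix constant vectors, so lowering every final weight by [lambda] lowers the
    weight of every word by [lambda]. *)
Lemma pfa_cutpoint_wfa (R : realType) (A : finType) (P : pfa R A) (lambda : R) :
  exists W : wfa R A, forall w, weight W w = pfa_prob P w - lambda.
Proof.
exists (@Wfa R A 'I_(pfa_dim P).+1 (@wfa_init R A (wfa_of_pfa P))
  (@wfa_trans R A (wfa_of_pfa P))
  (fun i => @wfa_fin R A (wfa_of_pfa P) i - lambda)) => w.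
set W := Wfa _ _ _.
have sum_shift (B : 'M[R]_((pfa_dim P).+1)) i (y : 'I_(pfa_dim P).+1 -> R) :
    stochastic B ->
    \sum_j B i j * (y j - lambda) = \sum_j B i j * y j - lambda.
  case=> _ sum1; under eq_bigr do rewrite mulrBr.
  by rewrite sumrB -mulr_suml sum1 mul1r.
have beh_w i : behaviour W w i = behaviour (wfa_of_pfa P) w i - lambda.
  elim: w i => [//|a w IHw] i /=; under eq_bigr do rewrite IHw.
  by rewrite -sum_shift //; exact: pfa_stochastic.
rewrite pfa_prob_weight /weight; under eq_bigr do rewrite beh_w.
by rewrite -sum_shift //; exact: pfa_stochastic.
Qed.

(** * From weighted automata to PFAs with cutpoint 1/2 *)

(* Turakainen's construction: each state is doubled by a sign, the transition
   weight is split into its positive and negative parts scaled by [K], and the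
   missing probability is shared equally by the two copies of the state [d], so
   that it contributes nothing to the signed weight. *)
Definition signed_trans (R : realFieldType) (T : finType) (d : T) (K : R)
    (B : T -> T -> R) (s s' : T * bool) : R :=
  (`|B s.1 s'.1| + (-1) ^+ (s.2 (+) s'.2) * B s.1 s'.1) / (2 * K)
  + (s'.1 == d)%:R * ((1 - (\sum_t `|B s.1 t|) / K) / 2).

(** Vectors of the form 1/2 plus or minus [y] keep this form, with [y] replaced by [B y / K]: the
    rows sum to 1, and the absolute values and the share of [d] cancel between opposite signs. *)
Lemma signed_trans_sum (R : realFieldType) (T : finType) (d : T) (K : R)
    (B : T -> T -> R) (s : T * bool) (y : T -> R) :
  K != 0 ->
  \sum_s' signed_trans d K B s s' * (2^-1 + (-1) ^+ s'.2 * y s'.1)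
    = 2^-1 + (-1) ^+ s.2 * (\sum_t B s.1 t * y t) / K.
Proof.
move=> K0; case: s => i b /=.
transitivity (\sum_j \sum_(b' : bool)
    signed_trans d K B (i, b) (j, b') * (2^-1 + (-1) ^+ b' * y j)).
  by rewrite pair_bigA; apply: eq_bigr => -[].
transitivity (\sum_j ((`|B i j| / (2 * K) + (-1) ^+ b * (B i j * y j) / K)
    + (j == d)%:R * ((1 - (\sum_t `|B i t|) / K) / 2))).
  apply: eq_bigr => j _; rewrite big_bool /signed_trans /=.
  by case: b; rewrite /= ?expr0 ?expr1; field.
rewrite !big_split /= -mulr_suml -mulr_suml -mulr_sumr.
rewrite [X in _ + X](bigD1 d) //= eqxx mul1r [X in _ + (_ + X)]big1 ?addr0; last first.
  by move=> j /negPf ->; rewrite mul0r.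
by field.
Qed.

Lemma signed_trans_ge0 (R : realFieldType) (T : finType) (d : T) (K : R)
    (B : T -> T -> R) (s s' : T * bool) :
  0 < K -> \sum_t `|B s.1 t| <= K -> 0 <= signed_trans d K B s s'.
Proof.
move=> K_gt0 leK; apply: addr_ge0.
  apply: divr_ge0; last by rewrite mulr_ge0 // ltW.
  rewrite -[X in X + _]opprK addrC subr_ge0 lerNl.
  apply: le_trans (_ : `|(-1) ^+ (s.2 (+) s'.2) * B s.1 s'.1| <= _).
    by rewrite -normrN ler_norm.
  by rewrite normrM normr_sign mul1r.
by rewrite mulr_ge0 ?ler0n // divr_ge0 // subr_ge0 ler_pdivrMr ?mul1r.
Qed.

Lemma signed_trans_sum1 (R : realFieldType) (T : finType) (d : T) (K : R)
    (B : T -> T -> R) (s : T * bool) :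
  K != 0 -> \sum_s' signed_trans d K B s s' = 1.
Proof.
(* With [y = 0] the preceding identity says that half the row sum is 1/2. *)
move=> K0; have := signed_trans_sum d B s (fun=> 0) K0.
under eq_bigr do rewrite mulr0 addr0.
rewrite -!mulr_suml !(mulr0, mul0r) addr0 -[RHS]mul1r.
by move/mulIf; apply; rewrite invr_eq0 pnatr_eq0.
Qed.

(** States are transported along an enumeration of [T]. The start state [s1] is whichever element
    comes first; [s0] ensures that there is one. *)
Lemma pfa_of_finType (R : realType) (A T : finType) (s0 : T)
    (tr : tape_symbol A -> T -> T -> R) (F : {set T}) :
  (forall x s s', 0 <= tr x s s') -> (forall x s, \sum_s' tr x s s' = 1) ->
  exists (P : pfa R A) (s1 : T), forall w,
    pfa_prob P w = weight (@Wfa R A T (tr LeftEnd s1) (fun a => tr (Letter a))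
      (fun s => \sum_(s' in F) tr RightEnd s s')) w.
Proof.
move=> tr_ge0 tr_sum1.
have card_T : #|T| = #|T|.-1.+1 by rewrite prednK //; apply/card_gt0P; exists s0.
pose f (i : 'I_(#|T|.-1.+1)) : T := enum_val (cast_ord (esym card_T) i).
have bij_f : bijective f.
  apply: bij_comp; first exact: enum_val_bij.
  exact: (Bijective (cast_ordK _) (cast_ordKV _)).
have sum_f (G : T -> R) : \sum_s G s = \sum_i G (f i).
  by rewrite (reindex f) //; exact: onW_bij.
pose M x : 'M[R]_(#|T|.-1.+1) := \matrix_(i, j) tr x (f i) (f j).
have M_stoch x : stochastic (M x).
  split=> [i j|i]; first by rewrite mxE.
  by under eq_bigr do rewrite mxE; rewrite -(sum_f (tr x (f i))).
exists (Pfa [set i | f i \in F] M_stoch), (f ord0) => w.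
set W := Wfa _ _ _; set P := Pfa _ _.
have beh_w i : behaviour (wfa_of_pfa P) w i = behaviour W w (f i).
  elim: w i => [|a w IHw] i /=.
    rewrite [RHS]big_mkcond sum_f -big_mkcond /=.
    by apply: eq_big => j; rewrite ?inE // mxE.
  by rewrite sum_f; apply: eq_bigr => j _; rewrite IHw mxE.
rewrite pfa_prob_weight /weight sum_f.
by apply: eq_bigr => j _; rewrite beh_w /= mxE.
Qed.

Lemma sum_option (V : nmodType) (T : finType) (F : option T -> V) :
  \sum_s F s = F None + \sum_t F (Some t).
Proof.
rewrite (bigD1 None) //=; congr (_ + _).
rewrite (reindex_omap Some id) /=; last by case.
by apply: eq_bigl => t; rewrite eqxx.
Qed.

(* The extra state [None] collects the final weights and serves as the neutral
   state of [signed_trans]; the start row ignores its source, so that any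
   state may be the start state. *)
Definition tape_trans (R : realFieldType) (A : finType) (W : wfa R A)
    (x : tape_symbol A) (s s' : option (wfa_state W)) : R :=
  match x, s', s with
  | LeftEnd, Some t', _ => wfa_init t'
  | Letter a, Some t', Some t => wfa_trans a t t'
  | RightEnd, None, Some t => wfa_fin t
  | _, _, _ => 0
  end.

(** One [K] serves all tape symbols, so the total scaling depends only on the length of the word. *)
Lemma tape_bound (R : realFieldType) (A T : finType)
    (B : tape_symbol A -> T -> T -> R) :
  exists2 K : R, 0 < K & forall x s, \sum_s' `|B x s s'| <= K.
Proof.
pose S x := \sum_s \sum_s' `|B x s s'|.
have S_ge0 x : 0 <= S x by do 2!apply: sumr_ge0 => ? _.
pose K : R := 1 + S LeftEnd + S RightEnd + \sum_a S (Letter a).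
have sum_ge0 : 0 <= \sum_a S (Letter a) by apply: sumr_ge0.
have K_gt0 : 0 < K.
  by rewrite /K; have := S_ge0 LeftEnd; have := S_ge0 RightEnd; lra.
exists K => // x s.
apply: le_trans (_ : S x <= K).
  by rewrite [leRHS](bigD1 s) //= lerDl; do 2!apply: sumr_ge0 => ? _.
have := S_ge0 LeftEnd; have := S_ge0 RightEnd; rewrite /K.
case: x => [||a]; [lra|lra|].
have : S (Letter a) <= \sum_a S (Letter a).
  by rewrite [leRHS](bigD1 a) //= lerDl sumr_ge0.
by lra.
Qed.

(** The acceptance probability is 1/2 plus or minus [weight W w / (2 * K ^+ (size w).+2)]. The sign
    comes from the start state and does not affect vanishing. *)
Lemma wfa_pfa (R : realType) (A : finType) (W : wfa R A) :
  exists P : pfa R A, forall w, (pfa_prob P w == 2^-1) = (weight W w == 0).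
Proof.
pose B := @tape_trans R A W.
have [K K_gt0 leK] := tape_bound B.
have K_neq0 : K != 0 by rewrite gt_eqF.
pose tr x := signed_trans None K (B x).
have [||P [[s1 b1] probP]] := @pfa_of_finType R A _ (None, false) tr [set (None, false)].
- by move=> x s s'; apply: signed_trans_ge0.
- by move=> x s; apply: signed_trans_sum1.
exists P => w; rewrite probP; set V := Wfa _ _ _.
have beh_w s : behaviour V w s = 2^-1
    + (-1) ^+ s.2 * (oapp (behaviour W w) 0 s.1 / (2 * K ^+ (size w).+1)).
  elim: w s => [|a w IHw] s /=.
    (* A [RightEnd] row is supported on [None], so at the accepting state the absolute value cancels
       against the missing probability, leaving 1/2 plus the signed term. *)
    have norm_sum : \sum_t `|B RightEnd s.1 t| = `|B RightEnd s.1 None|.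
      rewrite sum_option [X in _ + X]big1 ?addr0 // => t _.
      by case: s.1 => [?|]; rewrite normr0.
    rewrite big_set1 /tr /signed_trans /= norm_sum mul1r addbF expr1.
    by case: s.1 => [t|] /=; field.
  under eq_bigr do rewrite IHw.
  rewrite (signed_trans_sum _ _ _ (fun t => oapp (behaviour W w) 0 t / _)) //.
  rewrite sum_option /= !mul0r add0r.
  have -> : \sum_t B (Letter a) s.1 (Some t)
        * (behaviour W w t / (2 * K ^+ (size w).+1))
      = oapp (behaviour W (a :: w)) 0 s.1 / (2 * K ^+ (size w).+1).
    case: s.1 => [t|] /=; last by rewrite mul0r big1 // => t _; rewrite mul0r.
    by rewrite mulr_suml; apply: eq_bigr => t' _; rewrite mulrA.
  by rewrite [K ^+ (size w).+2]exprSr !invfM !mulrA.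
rewrite /weight; under eq_bigr do rewrite beh_w.
rewrite (signed_trans_sum _ _ _ (fun t => oapp (behaviour W w) 0 t / _)) //.
rewrite sum_option /= !mul0r add0r.
under [X in _ + _ * X / _]eq_bigr do rewrite mulrA.
rewrite -mulr_suml -subr_eq0 addrAC subrr add0r !mulf_eq0 signr_eq0 !invr_eq0.
by rewrite mulf_eq0 expf_eq0 pnatr_eq0 (negPf K_neq0) !orbF.
Qed.

Local Open Scope classical_set_scope.

Theorem theorem5p5 (R : realType) (Sigma Upsilon : finType)
    (h : Sigma -> seq Upsilon) (L : language Sigma) :
  exclusive_stochastic R L -> exclusive_stochastic R (hom_ext h @` L).
Proof.
move=> [P [lambda [_ ->]]].
have [W weightW] := pfa_cutpoint_wfa P lambda.
have [V supportV] := wfa_hom h W.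
have [Q probQ] := wfa_pfa V.
exists Q, 2^-1; split; first by rewrite invr_ge0 ler0n invf_le1 ?ler1n ?ltr0n.
rewrite eqEsubset; split=> w /=.
  case=> u /= /eqP; rewrite -subr_eq0 -weightW => nz_u <-.
  by apply/eqP; rewrite probQ; apply/supportV; exists u.
move/eqP; rewrite probQ => /supportV[u nz_u <-].
by exists u => //=; apply/eqP; rewrite -subr_eq0 -weightW.
Qed.
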